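(* Consider the affine control system on $\mathbb{R}^n$ $$\dot{x}(t)=A_{0}x(t)+a_{0}+\sum_{i=1}^{m}u_{i}(t)[A_{i}x(t)+a_{i}],\quad u\in\mathcal{U},$$ with control flow $\Psi$ on $\mathcal{U}\times\mathbb{R}^{n}$, and the control flow $\mathbb{P}\Psi^{1}$ on $\mathcal{U}\times\mathbb{P}^{n}$ of the control system on projective space $\mathbb{P}^{n}$ induced by the embedding bilinear system on $\mathbb{R}^{n+1}$. Let $\mathbb{P}^{n,1}=\{\mathbb{P}(x,1)\mid x\in\mathbb{R}^n\}\subset\mathbb{P}^n$ and let $\mathbb{P}h:\mathbb{R}^{n}\rightarrow\mathbb{P}^{n,1}$ be the map $\mathbb{P}h(x):=\mathbb{P}(x,1)$. (i) The map $\mathrm{id}_{\mathcal{U}}\times\mathbb{P}h:\mathcal{U}\times\mathbb{R}^{n}\rightarrow\mathcal{U}\times\mathbb{P}^{n,1}$ is a topological conjugation (i.e., a homeomorphism) of the flows $\Psi$ and $\mathbb{P}\Psi^{1}$ restricted to $\mathcal{U}\times\mathbb{P}^{n,1}$, hence $$(\mathrm{id}_{\mathcal{U}}\times\mathbb{P}h)\Psi_{t}(u,x)=\mathbb{P}\Psi_{t}^{1}(u,\mathbb{P}h(x))\quad\text{for }t\in\mathbb{R},\ (u,x)\in\mathcal{U}\times\mathbb{R}^{n}.$$ (ii) The maximal invariant strongly chain transitive sets for $\Psi$ are mapped by $\mathrm{id}_{\mathcal{U}}\times\mathbb{P}h$ onto the maximal invariant strongly chain transitive sets for $\mathbb{P}\Psi^{1}$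 restricted to $\mathcal{U}\times\mathbb{P}^{n,1}$. (iii) The strong chain control sets ${}_{\mathbb{P}}E^{\ast}$ on $\mathbb{P}^{n,1}$ are the sets of the form ${}_{\mathbb{P}}E^{\ast}=\mathbb{P}h(E^{\ast})$, where the $E^{\ast}$ are the strong chain control sets on $\mathbb{R}^{n}$.
   Context: Setting. $A_i\in\mathbb{R}^{n\times n}$, $a_i\in\mathbb{R}^n$, $i=0,\ldots,m$; $\Omega\subset\mathbb{R}^m$ is a convex and compact neighborhood of $0$; $\mathcal{U}=\{u\in L^\infty(\mathbb{R},\mathbb{R}^m)\mid u(t)\in\Omega\text{ for almost all }t\}$, with a metric compatible with the weak$^\ast$ topology of $L^\infty(\mathbb{R},\mathbb{R}^m)$ (then $\mathcal{U}$ is compact). Solutions of the affine system with $x(0)=x$ are $\psi(t,x,u)$, $t\in\mathbb{R}$, and $\Psi_t(u,x)=(u(t+\cdot),\psi(t,x,u))$. Products carry the maximum metric. Induced system. For $0\ne y\in\mathbb{R}^{n+1}$, $\mathbb{P}y\in\mathbb{P}^n$ is the corresponding point of projective space. The bilinear system on $\mathbb{R}^{n+1}$ $$\begin{pmatrix} \dot x \\ \dot z \end{pmatrix}=\begin{pmatrix} A_0 & a_0 \\ 0 & 0 \end{pmatrix}\begin{pmatrix} x \\ z \end{pmatrix}+\sum_{i=1}^m u_i(t)\begin{pmatrix} A_i & a_i \\ 0 & 0 \end{pmatrix}\begin{pmatrix} x \\ z \end{pmatrix}$$ has trajectories $\psi^1(t,x,z,u)$, linear in $(x,z)$. It induces the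 system on $\mathbb{P}^n$ with trajectories $\mathbb{P}\psi^1(t,\mathbb{P}y,u)=\mathbb{P}(\psi^1(t,y,u))$ and control flow $\mathbb{P}\Psi^1_t(u,p)=(u(t+\cdot),\mathbb{P}\psi^1(t,p,u))$. The set $\mathbb{P}^{n,1}$ is invariant. $\mathbb{P}^n$ carries a metric compatible with its topology, e.g. $d(\mathbb{P}s,\mathbb{P}s')=\min\{\|s-s'\|,\|s+s'\|\}$ for unit vectors $s,s'$; $\mathbb{P}^{n,1}$ carries the restricted metric. Strong chain transitivity for a continuous flow $\phi$ on a metric space $(X,d)$. Let $\mathcal{P}(X)$ be the set of continuous functions $\varepsilon:X\to(0,\infty)$. For $\varepsilon\in\mathcal{P}(X)$, $T>0$, an $(\varepsilon,T)$-chain from $x$ to $y$ consists of $k\ge1$, points $x_0=x,\ldots,x_k=y$ in $X$ and times $t_0,\ldots,t_{k-1}\ge T$ with $d(\phi(t_j,x_j),x_{j+1})<\varepsilon(\phi(t_j,x_j))$ for all $j$. A set $Y\subset X$ is strongly chain transitive if for all $x,y\in Y$, $T>0$, $\varepsilon\in\mathcal{P}(X)$ there is an $(\varepsilon,T)$-chain from $x$ to $y$. Invariant means $\phi(t,Y)\subset Y$ for all $t\in\mathbb{R}$; maximal is with respect to inclusion among invariant strongly chain transitive sets. Strong chain control sets (for a control system on a manifold $M$ with metric $d_M$ and trajectories $\varphi(t,x,u)$). For $\varepsilon\in\mathcal{P}(M)$, $T>0$, a controlled $(\varepsilon,T)$-chain from $x$ to $y$ consists of $k\ge1$, $T_0,\ldots,T_{k-1}\ge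 T$, $u_0,\ldots,u_{k-1}\in\mathcal{U}$, $x_0=x,\ldots,x_k=y\in M$ with $d_M(\varphi(T_j,x_j,u_j),x_{j+1})<\varepsilon(\varphi(T_j,x_j,u_j))$ for all $j$. A point $x$ is strongly chain controllable to $y$ if for every $\varepsilon\in\mathcal{P}(M)$ and $T>0$ there is a controlled $(\varepsilon,T)$-chain from $x$ to $y$. A nonvoid set $E^\ast\subset M$ is a strong chain control set if (1) every $x\in E^\ast$ is strongly chain controllable to every $y\in E^\ast$, (2) for every $x\in E^\ast$ there is $u\in\mathcal{U}$ with $\varphi(t,x,u)\in E^\ast$ for all $t\in\mathbb{R}$, and (3) $E^\ast$ is maximal with properties (1) and (2). *)

(* Defs.v *)
From HB Require Import structures.
From mathcomp Require Import all_boot all_order all_algebra.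
From mathcomp Require Import generic_quotient.
From mathcomp Require Import all_classical all_reals all_analysis measurable_realfun.

Set Implicit Arguments.
Unset Strict Implicit.
Unset Printing Implicit Defensive.

Import Order.TTheory GRing.Theory Num.Theory.
Import numFieldNormedType.Exports.

Local Open Scope classical_set_scope.
Local Open Scope ring_scope.
Local Open Scope quotient_scope.

Section controls.
Context {R : realType}.

Local Notation Rm := (measurableTypeR R).
Local Notation leb := (@lebesgue_measure R).

Lemma lee1y : (1 <= +oo :> \bar R)%E.
Proof. exact: leey. Qed.

Definition Linf := LspaceType leb lee1y.
Definition L1 := LspaceType leb (@lexx _ _ (1%E : \bar R)).

Definition translation (t : R) (s : Rm) : Rm := t + s.

Lemma measurable_translation (t : R) : measurable_fun setT (translation t).
Proof.
apply: continuous_measurable_fun => s.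
exact: (cvgD (cvg_cst _) cvg_id).
Qed.

HB.instance Definition _ (t : R) :=
  isMeasurableFun.Build _ _ _ _ (translation t) (measurable_translation t).

Lemma lebesgue_translation (t : R) (A : set Rm) : measurable A ->
  leb (translation t @^-1` A) = leb A.
Proof.
move=> mA; rewrite -[LHS]/(pushforward leb (translation t) A).
apply/esym/lebesgue_measure_unique => //= _ [[a b]] _ <-.
have -> : pushforward leb (translation t) `]a, b] = leb `]a - t, b - t].
  rewrite /pushforward; congr (leb _); apply/seteqP.
  by split => s /=; rewrite /translation !in_itv /= ltrBlDl lerBrDl.
rewrite !lebesgue_measure_itv/= !lte_fin ltrD2r.
by case: ifP => // _; rewrite -!EFinD opprD addrACA subrr addr0.
Qed.

Lemma ae_translation (t : R) (P : set R) :
  (\forall s \ae leb, P s) -> (\forall s \ae leb, P (t + s)).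
Proof.
case=> N [mN N0 PN]; exists (translation t @^-1` N); split.
- rewrite -[X in measurable X]setTI; exact: measurable_translation.
- by rewrite lebesgue_translation.
- by move=> s /= nP; apply: PN.
Qed.

Section shift.
Variables (t : R) (u : Linf).

Let g : {mfun Rm >-> Rm} := repr (LebesgueSpace.sort u) \o translation t.

Let v : {mfun_ leb, Rm >-> Rm} := \pi g.

Let v_ae : \forall s \ae leb, v s = u (t + s).
Proof. by have /eqmodP/asboolP := reprK v; apply: filterS => s /(_ I). Qed.

Let v_fin : finite_norm leb +oo%E v.
Proof.
have := Lebesgue_finite (s := u); rewrite /finite_norm unlock.
case: ifP => // _; apply: le_lt_trans; apply/ess_sup_inf.ess_supP.
have /(ae_translation t) ut := ess_sup_inf.ess_sup_ge leb (abse \o (EFin \o u)).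
by apply: filterS2 v_ae ut => s /= ->.
Qed.

HB.instance Definition _ := isFinLebesgue.Build _ _ _ leb _ lee1y v v_fin.

Definition Linf_shift : Linf := [the LspaceType leb lee1y of v].

Lemma Linf_shift_ae : \forall s \ae leb, Linf_shift s = u (t + s).
Proof. exact: v_ae. Qed.

End shift.

HB.instance Definition _ := gen_eqMixin Linf.
HB.instance Definition _ := gen_choiceMixin Linf.

Variable m : nat.

(* 'cV[Linf]_m is L^oo(R, R^m). An element of Linf or L1, used as a function,
   stands for a representative chosen in its a.e.-equality class; integrals and
   a.e. statements do not depend on the choice. *)
Definition pairing (u : 'cV[Linf]_m) (f : 'cV[L1]_m) : R :=
  \int[leb]_s (\sum_(i < m) u i 0 s * f i 0 s).

(* L^oo(R, R^m) with the weak-star topology: the initial topology of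
   the map u |-> <u, ->, that is, pointwise convergence on L^1(R, R^m). *)
Definition control : Type :=
  initial_topology (pairing : 'cV[Linf]_m -> {ptws 'cV[L1]_m -> R}).

HB.instance Definition _ := Topological.copy control
  (initial_topology (pairing : 'cV[Linf]_m -> {ptws 'cV[L1]_m -> R})).

Definition control_at (u : control) (s : R) : 'cV[R]_m :=
  \col_i (u : 'cV[Linf]_m) i 0 s.

Definition control_shift (t : R) (u : control) : control :=
  map_mx (Linf_shift t) (u : 'cV[Linf]_m).

Definition admissible (Omega : set 'cV[R]_m) : set control :=
  [set u | \forall s \ae leb, Omega (control_at u s)].

End controls.
Arguments Linf : clear implicits.
Arguments control : clear implicits.

Section projective.
Context {R : realType} (n : nat).

Definition nonzero : set 'cV[R]_(n + 1) := [set y | y != 0].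

Definition proportional (y z : nonzero) : bool :=
  `[< exists2 c : R, c != 0 & \val z = c *: \val y >].

Lemma proportional_refl : reflexive proportional.
Proof. by move=> y; apply/asboolP; exists 1; rewrite ?scale1r ?oner_eq0. Qed.

Lemma proportional_sym : symmetric proportional.
Proof.
suff H y z : proportional y z -> proportional z y.
  by move=> y z; apply/idP/idP; exact: H.
move=> /asboolP[c c0 zE]; apply/asboolP; exists c^-1; first by rewrite invr_eq0.
by rewrite zE scalerA mulVf// scale1r.
Qed.

Lemma proportional_trans : transitive proportional.
Proof.
move=> y x z /asboolP[c c0 yE] /asboolP[d d0 zE]; apply/asboolP.
by exists (d * c); rewrite ?mulf_neq0// zE yE scalerA.
Qed.

Canonical proportional_equiv :=
  EquivRel proportional proportional_refl proportional_sym proportional_trans.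

Definition proj_space : Type := quotient_topology {eq_quot proportional}.

HB.instance Definition _ := Topological.copy proj_space
  (quotient_topology {eq_quot proportional}).

Lemma ones_nonzero : (const_mx 1 : 'cV[R]_(n + 1)) \in nonzero.
Proof.
rewrite inE /nonzero /=; apply/eqP => /matrixP/(_ (rshift n ord0) 0).
by rewrite !mxE => /eqP; rewrite oner_eq0.
Qed.

(* The value at y = 0 is a dummy. *)
Definition proj_class (y : 'cV[R]_(n + 1)) : proj_space :=
  \pi_(quotient_topology {eq_quot proportional})
    (insubd (Sub (const_mx 1) ones_nonzero : nonzero) y).

Definition proj_repr (p : proj_space) : 'cV[R]_(n + 1) :=
  \val (repr (p : quotient_topology {eq_quot proportional})).

End projective.
Arguments proj_space : clear implicits.

Section systems.
Context {R : realType}.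

Local Notation leb := (@lebesgue_measure R).

(* A ord0 and a ord0 are the drift terms A_0 and a_0. *)
Definition vector_field (n m : nat) (A : 'I_m.+1 -> 'M[R]_n)
    (a : 'I_m.+1 -> 'cV[R]_n) (w : 'cV[R]_m) (x : 'cV[R]_n) : 'cV[R]_n :=
  A ord0 *m x + a ord0 +
  \sum_(i < m) w i 0 *: (A (lift ord0 i) *m x + a (lift ord0 i)).

Definition integral_from0 (f : R -> R) (t : R) : R :=
  if 0 <= t then \int[leb]_(s in `[0, t]) f s
  else - \int[leb]_(s in `[t, 0]) f s.

(* Caratheodory solution on the whole time axis, in integral form; since the
   control is essentially bounded, continuity of phi makes every component of
   the integrand integrable on bounded intervals. *)
Definition is_solution (n m : nat) (A : 'I_m.+1 -> 'M[R]_n)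
    (a : 'I_m.+1 -> 'cV[R]_n) (u : control R m) (x : 'cV[R]_n)
    (phi : R -> 'cV[R]_n) : Prop :=
  continuous phi /\
  forall t i, phi t i 0 = x i 0 + integral_from0
    (fun s => vector_field A a (control_at u s) (phi s) i 0) t.

Definition solution_map (n m : nat) (A : 'I_m.+1 -> 'M[R]_n)
    (a : 'I_m.+1 -> 'cV[R]_n) (U : set (control R m))
    (psi : R -> 'cV[R]_n -> control R m -> 'cV[R]_n) : Prop :=
  forall u x, U u -> is_solution A a u x (fun t => psi t x u).

Definition bilinear_part (n m : nat) (A : 'I_m.+1 -> 'M[R]_n)
    (a : 'I_m.+1 -> 'cV[R]_n) : 'I_m.+1 -> 'M[R]_(n + 1) :=
  fun i => block_mx (A i) (a i) 0 0.

(* For the bilinear system psi1 is linear in its second argument and never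
   vanishes on nonzero vectors, so the value does not depend on the
   representative of p. *)
Definition proj_trajectory (n m : nat)
    (psi1 : R -> 'cV[R]_(n + 1) -> control R m -> 'cV[R]_(n + 1))
    (t : R) (p : proj_space R n) (u : control R m) : proj_space R n :=
  proj_class (psi1 t (proj_repr p) u).

Definition proj_h (n : nat) (x : 'cV[R]_n) : proj_space R n :=
  proj_class (col_mx x (1%:M : 'cV[R]_1)).

Definition proj_affine (n : nat) : set (proj_space R n) := range (@proj_h n).

Definition control_flow (X : Type) (m : nat)
    (phi : R -> X -> control R m -> X) (t : R) (p : control R m * X) :
    control R m * X :=
  (control_shift t p.1, phi t p.2 p.1).

Definition id_proj_h (n m : nat) (p : control R m * 'cV[R]_n) :
    control R m * proj_space R n :=
  (p.1, proj_h p.2).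

End systems.
Arguments proj_h {R} n x.
Arguments proj_affine : clear implicits.
Arguments id_proj_h {R} n m p.

Section chains.
Context {R : realType}.

Definition homeomorphism_on (S T : topologicalType) (X : set S) (Y : set T)
    (f : S -> T) : Prop :=
  [/\ set_bij X Y f, {within X, continuous f} &
      exists2 g : T -> S, {within Y, continuous g} &
        forall x, X x -> g (f x) = x].

(* d is a metric on X inducing the subspace topology of X; its values outside
   X are irrelevant. *)
Record metric_on (T : topologicalType) (X : set T) (d : T -> T -> R) : Prop :=
  MetricOn {
    metric_on_eq0 : forall x y, X x -> X y -> d x y = 0 <-> x = y ;
    metric_on_sym : forall x y, X x -> X y -> d x y = d y x ;
    metric_on_triangle : forall x y z, X x -> X y -> X z ->
      d x z <= d x y + d y z ;
    metric_on_nbhs : forall x (B : set T), X x ->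
      within X (nbhs x) B <->
      exists2 r, 0 < r & forall y, X y -> d x y < r -> B y }.

Definition max_dist (S T : Type) (dS : S -> S -> R) (dT : T -> T -> R)
    (p q : S * T) : R :=
  Num.max (dS p.1 q.1) (dT p.2 q.2).

Definition euclidean_dist (n : nat) (x y : 'cV[R]_n) : R :=
  Num.sqrt (\sum_(i < n) (x i 0 - y i 0) ^+ 2).

Definition positive_continuous (T : topologicalType) (X : set T) :
    set (T -> R) :=
  [set e : T -> R | {within X, continuous e} /\ forall x, X x -> 0 < e x].

Section flows.
Variables (T : topologicalType) (X : set T) (d : T -> T -> R).
Variable phi : R -> T -> T.

(* The chain z_0 = x, ..., z_k = y stays in the state space X, which phi is
   meant to leave invariant. *)
Definition eps_chain (e : T -> R) (tau : R) (x y : T) : Prop :=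
  exists (k : nat) (z : nat -> T) (t : nat -> R),
    [/\ (0 < k)%N, z 0%N = x, z k = y,
        forall j, (j <= k)%N -> X (z j) &
        forall j, (j < k)%N -> tau <= t j /\
          d (phi (t j) (z j)) (z j.+1) < e (phi (t j) (z j))].

Definition strongly_chain_transitive (Y : set T) : Prop :=
  Y `<=` X /\
  forall x y, Y x -> Y y -> forall tau, 0 < tau ->
  forall e, positive_continuous X e -> eps_chain e tau x y.

Definition flow_invariant (Y : set T) : Prop := forall t, phi t @` Y `<=` Y.

Definition max_inv_strongly_chain_transitive : set (set T) :=
  [set Y | [/\ flow_invariant Y, strongly_chain_transitive Y &
    forall Z, flow_invariant Z -> strongly_chain_transitive Z -> Y `<=` Z ->
      Z = Y]].

End flows.

Section control_systems.
Variables (M : topologicalType) (X : set M) (d : M -> M -> R).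
Variables (C : Type) (U : set C) (phi : R -> M -> C -> M).

Definition controlled_chain (e : M -> R) (tau : R) (x y : M) : Prop :=
  exists (k : nat) (z : nat -> M) (t : nat -> R) (u : nat -> C),
    [/\ (0 < k)%N, z 0%N = x, z k = y,
        forall j, (j <= k)%N -> X (z j) &
        forall j, (j < k)%N -> [/\ tau <= t j, U (u j) &
          d (phi (t j) (z j) (u j)) (z j.+1) < e (phi (t j) (z j) (u j))]].

Definition strongly_chain_controllable (x y : M) : Prop :=
  forall e, positive_continuous X e -> forall tau, 0 < tau ->
  controlled_chain e tau x y.

Definition pre_strong_chain_control_set (E : set M) : Prop :=
  (forall x y, E x -> E y -> strongly_chain_controllable x y) /\
  (forall x, E x -> exists2 u, U u & forall t, E (phi t x u)).

Definition strong_chain_control_sets : set (set M) :=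
  [set E | [/\ E !=set0, E `<=` X, pre_strong_chain_control_set E &
    forall F, F `<=` X -> pre_strong_chain_control_set F -> E `<=` F ->
      F = E]].

End control_systems.
End chains.
Arguments euclidean_dist {R} n x y.

(* Main.v *)
Require Import Defs.
From mathcomp Require Import all_boot all_order all_algebra.
From mathcomp Require Import all_classical all_reals all_analysis.
From mathcomp Require Import generic_quotient measurable_realfun ring lra.

(* The homogeneous system is uniquely solvable, and (psi, 1) solves it whenever
   psi solves the affine system; uniqueness also gives homogeneity in the
   initial value, so P psi1 (t, P(x, 1), u) = P(psi (t, x, u), 1). The inverse of
   the chart P h is (x, z) |-> z^-1 x, which is continuous on the open set z <> 0.
   Strong chain transitivity and strong chain control sets are invariant under
   topological conjugation because a positive continuous tolerance e on the
   target pulls back to a positive continuous tolerance on the source: take the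
   distance of (x, x) to the closed set of pairs (z, z') with
   d (f z) (f z') >= e (f z), cut at 1. Invariant strongly chain transitive sets
   are the special case of a control system whose control range is a point. *)

Import Order.TTheory GRing.Theory Num.Theory.
Import numFieldNormedType.Exports.

Local Open Scope classical_set_scope.
Local Open Scope ring_scope.

(** * Chains under topological conjugation *)

Section metric_on_theory.
Context {R : realType}.

Lemma metric_on_refl (T : topologicalType) (X : set T) (d : T -> T -> R) x :
  metric_on X d -> X x -> d x x = 0.
Proof. by move=> md Xx; apply/(metric_on_eq0 md). Qed.

Lemma metric_on_ge0 (T : topologicalType) (X : set T) (d : T -> T -> R) x y :
  metric_on X d -> X x -> X y -> 0 <= d x y.
Proof.
move=> md Xx Xy; have := metric_on_triangle md Xx Xy Xx.
by rewrite (metric_on_refl _ _ _ _ md)// (metric_on_sym md Xy Xx); lra.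
Qed.

Lemma metric_on_subset (T : topologicalType) (X Y : set T) (d : T -> T -> R) :
  Y `<=` X -> metric_on X d -> metric_on Y d.
Proof.
move=> YX md; split.
- by move=> x y /YX Xx /YX Xy; exact: metric_on_eq0 md _ _ Xx Xy.
- by move=> x y /YX Xx /YX Xy; exact: metric_on_sym md _ _ Xx Xy.
- by move=> x y z /YX Xx /YX Xy /YX Xz; exact: metric_on_triangle md _ _ _ Xx Xy Xz.
move=> x B Yx; have Xx := YX _ Yx; split.
  (* Requiring [B] only on [Y] turns a neighbourhood within [Y] into one within [X]. *)
  move=> YB; have : within X (nbhs x) (fun y => Y y -> B y).
    by rewrite /within/= in YB *; apply: filterS YB => y + _.
  move=> /(metric_on_nbhs md _ Xx)[r r0 rB].
  by exists r => // y Yy dxy; apply: (rB y (YX _ Yy) dxy).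
move=> [r r0 rB].
have : within X (nbhs x) (fun y => d x y < r).
  by apply/(metric_on_nbhs md _ Xx); exists r.
by rewrite /within/=; apply: filterS => y dxy Yy; apply: rB (dxy (YX _ Yy)).
Qed.

Lemma metric_on_prod (S T : topologicalType) (X : set S) (Y : set T)
    (dX : S -> S -> R) (dY : T -> T -> R) :
  metric_on X dX -> metric_on Y dY -> metric_on (X `*` Y) (max_dist dX dY).
Proof.
move=> mX mY; split.
- move=> [x y] [x' y'] [/= Xx Yy] [/= Xx' Yy']; rewrite /max_dist/=; split.
    have := metric_on_ge0 _ _ _ _ _ mX Xx Xx'.
    have := metric_on_ge0 _ _ _ _ _ mY Yy Yy' => d0 d0' dE.
    have : Num.max (dX x x') (dY y y') <= 0 by rewrite dE.
    rewrite ge_max => /andP[dx dy].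
    by congr pair; [apply/(metric_on_eq0 mX)|apply/(metric_on_eq0 mY)] => //; lra.
  by case=> <- <-; rewrite (metric_on_refl _ _ _ _ mX)// (metric_on_refl _ _ _ _ mY)// maxxx.
- move=> [x y] [x' y'] [/= Xx Yy] [/= Xx' Yy']; rewrite /max_dist/=.
  by rewrite (metric_on_sym mX)// (metric_on_sym mY).
- move=> [x y] [x' y'] [x2 y2] [/= Xx Yy] [/= Xx' Yy'] [/= Xx2 Yy2].
  rewrite /max_dist/= ge_max; apply/andP; split.
    by apply: le_trans (metric_on_triangle mX Xx Xx' Xx2) _; rewrite lerD// le_max lexx.
  by apply: le_trans (metric_on_triangle mY Yy Yy' Yy2) _; rewrite lerD// le_max lexx orbT.
move=> [x y] B [/= Xx Yy]; split.
  move=> [[P Q] [/= Px Qy]] PQ.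
  have : within X (nbhs x) P by rewrite /within/=; apply: filterS Px => z + _.
  move=> /(metric_on_nbhs mX _ Xx)[r r0 rP].
  have : within Y (nbhs y) Q by rewrite /within/=; apply: filterS Qy => z + _.
  move=> /(metric_on_nbhs mY _ Yy)[s s0 sQ].
  exists (Num.min r s); first by rewrite lt_min r0.
  move=> [x' y'] [/= Xx' Yy']; rewrite /max_dist gt_max !lt_min/=.
  move=> /andP[/andP[xr _] /andP[_ ys]].
  by apply: (PQ (x', y')); split => //=; [exact: rP|exact: sQ].
move=> [r r0 rB].
have Px : within X (nbhs x) (fun z => dX x z < r).
  by apply/(metric_on_nbhs mX _ Xx); exists r.
have Qy : within Y (nbhs y) (fun z => dY y z < r).
  by apply/(metric_on_nbhs mY _ Yy); exists r.
exists ((fun z => X z -> dX x z < r), (fun z => Y z -> dY y z < r)) => //.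
move=> [x' y'] [/= xx yy] [/= Xx' Yy']; apply: rB => //.
by rewrite /max_dist/= gt_max xx// yy.
Qed.

(* [e x] is the distance from [(x, x)] to the complement of [G], cut at [1]. *)
Lemma continuous_gauge (T : topologicalType) (X : set T) (d : T -> T -> R)
    (G : T -> T -> Prop) : metric_on X d ->
  (forall x, X x -> exists2 r, 0 < r & forall z z', X z -> X z' ->
     d x z < r -> d x z' < r -> G z z') ->
  exists2 e, positive_continuous X e &
    forall x x', X x -> X x' -> d x x' < e x -> G x x'.
Proof.
move=> md openG.
pose D x := [set r : R | r = 1 \/ exists z z',
  [/\ X z, X z', ~ G z z' & r = Num.max (d x z) (d x z')]].
have D1 x : D x !=set0 by exists 1; left.
have D0 x : X x -> lbound (D x) 0.
  move=> Xx r [->//|[z [z' [Xz Xz' _ ->]]]].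
  by rewrite le_max (metric_on_ge0 _ _ _ _ _ md Xx Xz).
have hasD x : X x -> has_inf (D x) by move=> Xx; split => //; exists 0; exact: D0.
pose e x := inf (D x).
(* [e] is 1-Lipschitz: replacing [x] by [y] changes the distance to any pair by at most [d x y].
   Continuity follows from this. *)
have lip x y : X x -> X y -> e x <= e y + d x y.
  move=> Xx Xy; rewrite -lerBlDr; apply: lb_le_inf => // r [->|[z [z' [Xz Xz' nG ->]]]].
    rewrite lerBlDr; apply: le_trans (_ : 1 <= _).
      by apply: ge_inf; [case: (hasD x Xx)|left].
    by have := metric_on_ge0 _ _ _ _ _ md Xx Xy; lra.
  rewrite lerBlDr; apply: (@le_trans _ _ (Num.max (d x z) (d x z'))).
    by apply: ge_inf; [case: (hasD x Xx)|right; exists z, z'].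
  have tz := metric_on_triangle md Xx Xy Xz.
  have tz' := metric_on_triangle md Xx Xy Xz'.
  rewrite ge_max; apply/andP; split.
    by apply: le_trans tz _; rewrite addrC lerD2r le_max lexx.
  by apply: le_trans tz' _; rewrite addrC lerD2r le_max lexx orbT.
exists e; first split.
- apply/subspace_continuousP => x Xx; apply/cvgrPdist_lt => eps eps0.
  apply/(metric_on_nbhs md _ Xx); exists eps => // y Xy dxy.
  have := lip _ _ Xx Xy; have := lip _ _ Xy Xx; rewrite (metric_on_sym md Xy Xx).
  by move=> ? ?; rewrite ltr_distl; apply/andP; split; lra.
- move=> x Xx; have [r r0 rG] := openG x Xx.
  apply: (@lt_le_trans _ _ (Num.min 1 r)); first by rewrite lt_min ltr01.
  apply: lb_le_inf => // s [->|[z [z' [Xz Xz' nG ->]]]].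
    by rewrite ge_min lexx.
  rewrite leNgt; apply/negP; rewrite gt_max !lt_min => /andP[/andP[_ a] /andP[_ b]].
  exact/nG/rG.
(* If [G x x'] fails, then [(x, x')] is itself a bad pair, at distance [d x x'] from [(x, x)]; hence
   [e x <= d x x']. *)
move=> x x' Xx Xx'; apply: contraPP => nG; apply/negP; rewrite -leNgt.
apply: ge_inf; first by case: (hasD x Xx).
right; exists x, x'; split => //.
by rewrite (metric_on_refl _ _ _ _ md Xx) max_r// (metric_on_ge0 _ _ _ _ _ md).
Qed.

(** The relation [dY (f z) (f z') < e (f z)] holds near every diagonal point, because [f] and [e]
    are continuous, so its gauge is a tolerance on the source. As [f] need not be uniformly
    continuous, a constant tolerance would not do. *)
Lemma pullback_gauge (S T : topologicalType) (X : set S) (Y : set T)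
    (dX : S -> S -> R) (dY : T -> T -> R) (f : S -> T) (e : T -> R) :
  metric_on X dX -> metric_on Y dY -> {within X, continuous f} ->
  set_fun X Y f -> positive_continuous Y e ->
  exists2 e', positive_continuous X e' & forall x x', X x -> X x' ->
    dX x x' < e' x -> dY (f x) (f x') < e (f x).
Proof.
move=> mX mY /subspace_continuousP fC fXY [/subspace_continuousP eC e0].
apply: continuous_gauge => // x Xx; have Yfx := fXY _ Xx.
(* Near [f x] the tolerance stays above [e (f x) / 2], while two points within [e (f x) / 4] of
   [f x] are less than [e (f x) / 2] apart. *)
have ex0 := e0 _ Yfx; have e2 : 0 < e (f x) / 2 by lra.
have e4 : 0 < e (f x) / 4 by lra.
have /cvgrPdist_lt /(_ _ e2) /(metric_on_nbhs mY _ Yfx)[r r0 re] := eC _ Yfx.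
have near_fx : within Y (nbhs (f x)) (fun y => dY (f x) y < Num.min r (e (f x) / 4)).
  by apply/(metric_on_nbhs mY _ Yfx); exists (Num.min r (e (f x) / 4)) => //; rewrite lt_min r0.
have : within X (nbhs x) (fun z => Y (f z) -> dY (f x) (f z) < Num.min r (e (f x) / 4)).
  exact: fC x Xx _ near_fx.
move=> /(metric_on_nbhs mX _ Xx)[s s0 sP].
exists s => // z z' Xz Xz' xz xz'.
have := sP z Xz xz (fXY _ Xz); rewrite lt_min => /andP[zr z4].
have := sP z' Xz' xz' (fXY _ Xz'); rewrite lt_min => /andP[_ z4'].
have := re _ (fXY _ Xz) zr; rewrite /from_subspace ltr_distlC => /andP[ez _].
have := metric_on_triangle mY (fXY _ Xz) Yfx (fXY _ Xz').
rewrite (metric_on_sym mY (fXY _ Xz) Yfx).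
lra.
Qed.
End metric_on_theory.

(** * Images of chains and of maximal sets *)

Section conjugation.
Context {R : realType} {S T : topologicalType} {C : Type}.

(** Surjectivity turns the one-sided inverse of the definition into a two-sided one, so results for
    [f] can be reused for [g]. *)
Lemma homeomorphism_on_inv (X : set S) (Y : set T) (f : S -> T) :
  homeomorphism_on X Y f ->
  exists2 g : T -> S, homeomorphism_on Y X g &
    {in X, cancel f g} /\ {in Y, cancel g f}.
Proof.
move=> [[fXY finj fsurj] fC [g gC fK]].
have gK y : Y y -> f (g y) = y by move=> /fsurj[x Xx <-]; rewrite fK.
exists g; last by split => z; rewrite inE; [exact: fK|exact: gK].
split => //; last by exists f.
split.
- by move=> y /fsurj[x Xx <-]; rewrite /= fK.
- move=> y y'; rewrite !inE => Yy Yy' gE.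
  by rewrite -(gK y Yy) gE gK.
- by move=> x Xx; exists (f x); [exact: fXY|exact: fK].
Qed.

Variables (U : set C) (X : set S) (Y : set T).
Variables (dX : S -> S -> R) (dY : T -> T -> R).
Variables (phi : R -> S -> C -> S) (chi : R -> T -> C -> T).
Hypothesis mX : metric_on X dX.
Hypothesis mY : metric_on Y dY.
Hypothesis phiX : forall t x u, X x -> U u -> X (phi t x u).

(** A chain for the pulled-back tolerance is mapped pointwise, with the same times and controls, to
    a chain for [e]. The converse direction is this lemma for the inverse map. *)
Lemma pre_strong_chain_control_set_image (f : S -> T) (E : set S) :
  homeomorphism_on X Y f ->
  (forall t x u, X x -> U u -> f (phi t x u) = chi t (f x) u) ->
  E `<=` X -> pre_strong_chain_control_set X dX U phi E ->
  pre_strong_chain_control_set Y dY U chi (f @` E).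
Proof.
move=> [[fXY _ _] fC _] fphi EX [Echain Einv]; split; last first.
  move=> _ [x Ex <-]; have [u Uu xE] := Einv x Ex.
  by exists u => // t; exists (phi t x u) => //; apply: fphi => //; exact: EX.
move=> _ _ [x Ex <-] [y Ey <-] e pe tau tau0.
have [e' pe' e'e] := pullback_gauge _ _ _ _ _ _ _ _ mX mY fC fXY pe.
have [k [z [t [u [k0 z0 zk zX zP]]]]] := Echain x y Ex Ey e' pe' tau tau0.
exists k, (f \o z), t, u; split => //=; [by rewrite z0|by rewrite zk| |].
  by move=> j /zX /fXY.
move=> j jk; have [tj Uj dj] := zP j jk; split => //.
have Xj := zX j (ltnW jk); rewrite -fphi//; apply: e'e => //; first exact: phiX.
exact: zX.
Qed.

End conjugation.

Definition maximal_in {T : Type} (P : set (set T)) : set (set T) :=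
  [set A | P A /\ forall B, P B -> A `<=` B -> B = A].

(** Images under [f] and under [g] are mutually inverse, inclusion-preserving operations between the
    sets in [P] and those in [Q], so they match maximal elements. *)
Lemma image_maximal_in {S T : Type} (X : set S) (Y : set T)
    (f : S -> T) (g : T -> S) (P : set (set S)) (Q : set (set T)) :
  {in X, cancel f g} -> {in Y, cancel g f} ->
  (forall A, P A -> A `<=` X) -> (forall B, Q B -> B `<=` Y) ->
  (forall A, P A -> Q (f @` A)) -> (forall B, Q B -> P (g @` B)) ->
  [set f @` A | A in maximal_in P] = maximal_in Q.
Proof.
move=> fK gK PX QY PQ QP.
have fgK B : Q B -> f @` (g @` B) = B.
  move=> /QY BY; apply/seteqP; split=> [_ [_ [y By <-] <-]|y By].
    by rewrite gK ?inE//; exact: BY.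
  by exists (g y); [exists y|rewrite gK ?inE//; exact: BY].
have gfK A : P A -> g @` (f @` A) = A.
  move=> /PX AX; apply/seteqP; split=> [_ [_ [x Ax <-] <-]|x Ax].
    by rewrite fK ?inE//; exact: AX.
  by exists (f x); [exists x|rewrite fK ?inE//; exact: AX].
apply/seteqP; split => [_ [A [PA Amax] <-]|B [QB Bmax]].
  split; first exact: PQ.
  move=> B QB AB; rewrite -(Amax (g @` B)) ?fgK//; first exact: QP.
  by rewrite -[X in X `<=` _]gfK//; exact: image_subset.
exists (g @` B); last exact: fgK.
split; first exact: QP.
move=> A PA BA; rewrite -(Bmax (f @` A)) ?gfK//; first exact: PQ.
by rewrite -[X in X `<=` _]fgK//; exact: image_subset.
Qed.

Section conjugate_systems.
Context {R : realType} {S T : topologicalType} {C : Type}.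
Variables (U : set C) (X : set S) (Y : set T).
Variables (dX : S -> S -> R) (dY : T -> T -> R).
Variables (phi : R -> S -> C -> S) (chi : R -> T -> C -> T) (f : S -> T).
Hypothesis mX : metric_on X dX.
Hypothesis mY : metric_on Y dY.
Hypothesis phiX : forall t x u, X x -> U u -> X (phi t x u).
Hypothesis homeof : homeomorphism_on X Y f.
Hypothesis fphi :
  forall t x u, X x -> U u -> f (phi t x u) = chi t (f x) u.

Lemma image_maximal_pre_strong_chain_control_set :
  [set f @` E | E in maximal_in [set E | E `<=` X /\
    pre_strong_chain_control_set X dX U phi E]] =
  maximal_in [set E | E `<=` Y /\ pre_strong_chain_control_set Y dY U chi E].
Proof.
have [g homeog [fK gK]] := homeomorphism_on_inv _ _ _ homeof.
have [[fXY _ _] _ _] := homeof; have [[gYX _ _] _ _] := homeog.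
apply: (image_maximal_in X Y f g) => //.
- by move=> E [].
- by move=> E [].
- move=> E [EX preE]; split; first by move=> _ [x /EX /fXY ? <-].
  exact: (pre_strong_chain_control_set_image U X Y dX dY phi chi).
move=> E [EY preE]; split; first by move=> _ [y /EY /gYX ? <-].
(* Since each [y] in [Y] equals [f (g y)], the set [Y] is invariant under [chi], and [g] conjugates
   [chi] to [phi]. *)
apply: (pre_strong_chain_control_set_image U Y X dY dX chi phi) => //.
  move=> t y u Yy Uu; have Xgy := gYX _ Yy.
  by rewrite -(gK y) ?inE// -fphi//; apply: fXY; exact: phiX.
move=> t y u Yy Uu; have Xgy := gYX _ Yy.
by rewrite -[X in chi t X u](gK y) ?inE// -fphi// fK// inE; exact: phiX.
Qed.

(** Nonemptiness is not part of [maximal_in]; it is split off and carried along separately, since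
    images preserve and reflect it. *)
Lemma image_strong_chain_control_sets :
  [set f @` E | E in strong_chain_control_sets X dX U phi] =
  strong_chain_control_sets Y dY U chi.
Proof.
have sccsE (Z : topologicalType) (W : set Z) d (om : R -> Z -> C -> Z) E :
    strong_chain_control_sets W d U om E <-> E !=set0 /\
    maximal_in [set E | E `<=` W /\ pre_strong_chain_control_set W d U om E] E.
  split=> [[E0 EW preE maxE]|[E0 [[EW preE] maxE]]].
    by split => //; split => // F [FW preF]; exact: maxE.
  by split => // F FW preF; exact: maxE.
have maxE := image_maximal_pre_strong_chain_control_set.
apply/seteqP; split => [_ [E /sccsE[[x Ex] mE] <-]|F /sccsE[[y Fy] mF]].
  apply/sccsE; split; first by exists (f x), x.
  by rewrite -maxE; exists E.
move: mF; rewrite -maxE => -[E mE EF]; exists E => //; apply/sccsE; split => //.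
by move: Fy; rewrite -EF => -[x Ex _]; exists x.
Qed.

End conjugate_systems.

(** With one control value, the control keeping a trajectory in [E] is forced, so its existence is
    flow invariance. The comparison is with [maximal_in] because the left side does not exclude the
    empty set. *)
Lemma max_inv_strongly_chain_transitiveE {R : realType} (T : topologicalType)
    (X : set T) (d : T -> T -> R) (phi : R -> T -> T) :
  max_inv_strongly_chain_transitive X d phi =
  maximal_in [set E | E `<=` X /\ pre_strong_chain_control_set X d
    [set: unit] (fun t x _ => phi t x) E].
Proof.
have chainE e tau x y : eps_chain X d phi e tau x y <->
    controlled_chain X d [set: unit] (fun t x _ => phi t x) e tau x y.
  split=> [[k [z [t [k0 z0 zk zX zP]]]]|[k [z [t [u [k0 z0 zk zX zP]]]]]].
    by exists k, z, t, (fun=> tt); split => // j /zP[].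
  by exists k, z, t; split => // j /zP[].
have preE E : flow_invariant phi E /\ strongly_chain_transitive X d phi E <->
    E `<=` X /\ pre_strong_chain_control_set X d
      [set: unit] (fun t x _ => phi t x) E.
  split=> [[Einv [EX Echain]]|[EX [Echain Einv]]].
    split => //; split.
      by move=> x y Ex Ey e pe tau tau0; apply/chainE; exact: Echain.
    by move=> x Ex; exists tt => // t; apply: (Einv t); exists x.
  split; last split => //.
    by move=> t _ [x Ex <-]; have [_ _] := Einv x Ex; exact.
  by move=> x y Ex Ey tau tau0 e pe; apply/chainE; exact: Echain.
apply/seteqP; split=> [E [inE tE maxE]|E [/preE[inE tE] maxE]].
  by split; [exact/preE|move=> F /preE[iF tF]; exact: maxE].
by split => // F iF tF; apply: maxE; exact/preE.
Qed.

Lemma image_max_inv_strongly_chain_transitive {R : realType}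
    (S T : topologicalType) (X : set S) (Y : set T)
    (dX : S -> S -> R) (dY : T -> T -> R)
    (phi : R -> S -> S) (chi : R -> T -> T) (f : S -> T) :
  metric_on X dX -> metric_on Y dY -> (forall t x, X x -> X (phi t x)) ->
  homeomorphism_on X Y f ->
  (forall t x, X x -> f (phi t x) = chi t (f x)) ->
  [set f @` E | E in max_inv_strongly_chain_transitive X dX phi] =
  max_inv_strongly_chain_transitive Y dY chi.
Proof.
move=> mX mY phiX homeof fphi; rewrite !max_inv_strongly_chain_transitiveE.
apply: image_maximal_pre_strong_chain_control_set => //.
  by move=> t x _ Xx _; exact: phiX.
by move=> t x _ Xx _; exact: fphi.
Qed.

(** * The Euclidean metric *)

Section euclidean.
Context {R : realType}.

(** Minkowski's inequality: after squaring it amounts to Cauchy-Schwarz. *)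
Lemma sqrt_sum_sqrD {I : finType} (a b : I -> R) :
  Num.sqrt (\sum_i (a i + b i) ^+ 2) <=
  Num.sqrt (\sum_i a i ^+ 2) + Num.sqrt (\sum_i b i ^+ 2).
Proof.
set p := Num.sqrt (\sum_i a i ^+ 2); set q := Num.sqrt (\sum_i b i ^+ 2).
have sum0 (c : I -> R) : 0 <= \sum_i c i ^+ 2 by apply: sumr_ge0 => i _; exact: sqr_ge0.
have p0 : 0 <= p := sqrtr_ge0 _; have q0 : 0 <= q := sqrtr_ge0 _.
have pE : \sum_i a i ^+ 2 = p ^+ 2 by rewrite sqr_sqrtr.
have qE : \sum_i b i ^+ 2 = q ^+ 2 by rewrite sqr_sqrtr.
have sumE (s t : R) : \sum_i (s * a i + t * b i) ^+ 2 =
    s ^+ 2 * p ^+ 2 + t ^+ 2 * q ^+ 2 + 2 * s * t * \sum_i a i * b i.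
  rewrite -pE -qE !mulr_sumr -!big_split/=; apply: eq_bigr => i _; ring.
suff CS : \sum_i a i * b i <= p * q.
  rewrite -(@ler_pXn2r _ 2)// ?nnegrE ?addr_ge0 ?sqrtr_ge0//.
  rewrite sqr_sqrtr//; have := sumE 1 1.
  under eq_bigr do rewrite !mul1r.
  move=> ->; nra.
(* A vanishing norm forces all entries to vanish; treating this first allows division by [p * q]
   below. *)
have [p00|pneq0] := eqVneq p 0.
  rewrite p00 mul0r big1// => i _.
  move: pE; rewrite p00 expr0n/= => /psumr_eq0P.
  by move=> /(_ (fun i _ => sqr_ge0 _) i isT)/eqP; rewrite sqrf_eq0 => /eqP->; rewrite mul0r.
have [q00|qneq0] := eqVneq q 0.
  rewrite q00 mulr0 big1// => i _.
  move: qE; rewrite q00 expr0n/= => /psumr_eq0P.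
  by move=> /(_ (fun i _ => sqr_ge0 _) i isT)/eqP; rewrite sqrf_eq0 => /eqP->; rewrite mulr0.
have pq0 : 0 < p * q by rewrite mulr_gt0// lt_neqAle eq_sym ?pneq0 ?qneq0.
(* This sum of squares equals [2 * p * q * (p * q - \sum_i a i * b i)]. *)
have := sum0 (fun i => q * a i + - p * b i); rewrite sumE => H.
rewrite -(ler_pM2l pq0); lra.
Qed.

Lemma nbhs_colP (n : nat) (x : 'cV[R]_n) (B : set 'cV[R]_n) : nbhs x B <->
  exists2 r, 0 < r & forall y : 'cV[R]_n, (forall i, `|x i 0 - y i 0| < r) -> B y.
Proof.
rewrite nbhs_ballP; split=> -[r r0 rB]; exists r => //.
  by move=> y xy; apply: rB; split => // i j; rewrite (ord1 j); exact: xy.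
by move=> y [_ xy]; apply: rB => i; exact: xy.
Qed.

Lemma metric_on_euclidean (n : nat) :
  metric_on [set: 'cV[R]_n] (euclidean_dist n).
Proof.
have coord (x y : 'cV[R]_n) i : `|x i 0 - y i 0| <= euclidean_dist n x y.
  rewrite -sqrtr_sqr ler_wsqrtr// (bigD1 i)//= lerDl.
  by apply: sumr_ge0 => j _; exact: sqr_ge0.
split.
- move=> x y _ _; split=> [d0|->].
    apply/matrixP => i j; rewrite (ord1 j); apply/eqP; rewrite -subr_eq0 -normr_le0.
    by rewrite -d0; exact: coord.
  by rewrite /euclidean_dist big1 ?sqrtr0// => i _; rewrite subrr expr0n.
- move=> x y _ _; congr Num.sqrt; apply: eq_bigr => i _.
  by rewrite -sqrrN opprB.
- move=> x y z _ _ _; rewrite /euclidean_dist.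
  rewrite (eq_bigr (fun i => ((x i 0 - y i 0) + (y i 0 - z i 0)) ^+ 2)).
    exact: sqrt_sum_sqrD.
  by move=> i _; rewrite addrA subrK.
move=> x B _; split.
  move=> xB; have : nbhs x B by move: xB; rewrite /within/=; apply: filterS => y; exact.
  move=> /nbhs_colP[r r0 rB]; exists r => // y _ dxy; apply: rB => i.
  exact: le_lt_trans (coord x y i) dxy.
move=> [r r0 rB]; rewrite /within/=; apply/nbhs_colP.
(* The sum of squares is then at most [n * r ^ 2 / (n + 1) ^ 2 < r ^ 2]; the [+ 1] also covers
   [n = 0]. *)
exists (r / n.+1%:R); first by rewrite divr_gt0.
move=> y xy _; apply: rB => //; rewrite /euclidean_dist.
apply: (@le_lt_trans _ _ (Num.sqrt (\sum_(i < n) (r / n.+1%:R) ^+ 2))).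
  rewrite ler_wsqrtr//; apply: ler_sum => i _.
  by rewrite -real_normK ?num_real// ler_sqr ?nnegrE ?(ltW (xy i))// ltW// divr_gt0.
rewrite sumr_const card_ord -[X in _ < X]gtr0_norm// -sqrtr_sqr ltr_sqrt ?exprn_gt0//.
rewrite expr_div_n -[_ *+ n]mulr_natr -mulrA gtr_pMr ?exprn_gt0//.
rewrite mulrC ltr_pdivrMr ?exprn_gt0// mul1r -natrX ltr_nat.
by rewrite expnS expn1; apply: leq_trans (leq_pmulr _ _).
Qed.

Lemma cvg_mx {T : Type} (F : set_system T) {FF : Filter F} (m n : nat)
    (f : T -> 'M[R]_(m, n)) (M : 'M[R]_(m, n)) :
  (forall i j, f x i j @[x --> F] --> M i j) -> f @ F --> M.
Proof.
move=> fM; apply/cvg_ballP => e e0.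
have : \forall x \near F, forall p : 'I_m * 'I_n, ball (M p.1 p.2) e (f x p.1 p.2).
  by apply: filter_forall => -[i j]; move: (fM i j) => /cvg_ballP/(_ _ e0).
by apply: filterS => x Hx; split => // i j; exact: (Hx (i, j)).
Qed.

End euclidean.

(** * The affine chart of projective space *)

Section projective_chart.
Context {R : realType} {n : nat}.
Local Open Scope quotient_scope.

Lemma pi_nonzero_class (z : @nonzero R n) :
  \pi_(quotient_topology {eq_quot (@proportional R n)}) z = proj_class (val z).
Proof. by rewrite /proj_class valKd. Qed.

Lemma proj_repr_neq0 (p : proj_space R n) : proj_repr p != 0.
Proof. by have := valP (repr p); rewrite inE. Qed.

Lemma proj_reprK : cancel (@proj_repr R n) (@proj_class R n).
Proof. by move=> p; rewrite /proj_repr -pi_nonzero_class; exact: reprK. Qed.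

Lemma proj_class_eqP (y z : 'cV[R]_(n + 1)) : y != 0 -> z != 0 ->
  proj_class y = proj_class z <-> exists2 c, c != 0 & z = c *: y.
Proof.
move=> y0 z0.
have E : reflect (proj_class y = proj_class z)
    (proportional (insubd (Sub (const_mx 1) (@ones_nonzero R n) : @nonzero R n) y)
      (insubd (Sub (const_mx 1) (@ones_nonzero R n) : @nonzero R n) z)).
  exact: (@eqmodP _ (@proportional_equiv R n)).
split=> [/E/asboolP|H]; first by rewrite !insubdK ?inE.
by apply/E/asboolP; rewrite !insubdK ?inE.
Qed.

Lemma proj_class_scale (c : R) (y : 'cV[R]_(n + 1)) :
  c != 0 -> y != 0 -> proj_class (c *: y) = proj_class y.
Proof.
move=> c0 y0; apply/esym/proj_class_eqP => //; last by exists c.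
by rewrite scaler_eq0 negb_or c0.
Qed.

Lemma proj_repr_class (y : 'cV[R]_(n + 1)) : y != 0 ->
  exists2 c : R, c != 0 & proj_repr (proj_class y) = c *: y.
Proof.
move=> y0; apply/proj_class_eqP => //; first exact: proj_repr_neq0.
by rewrite proj_reprK.
Qed.

(** A map avoiding 0 lifts to the subtype of nonzero vectors, whose topology is initial for the
    inclusion; the quotient map does the rest. *)
Lemma proj_class_continuous (T : topologicalType) (f : T -> 'cV[R]_(n + 1)) :
  continuous f -> (forall x, f x != 0) -> continuous (@proj_class R n \o f).
Proof.
move=> fC f0.
pose F x : @nonzero R n := insubd (Sub (const_mx 1) (@ones_nonzero R n) : @nonzero R n) (f x).
have FC : continuous F.
  apply: continuous_comp_initial.
  rewrite (_ : _ \o _ = f)//; apply/funext => x /=.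
  by rewrite -[LHS]/(val (F x)) insubdK // inE; exact: f0.
by move=> x; apply: (continuous_comp (FC x)); exact: pi_continuous.
Qed.

Lemma col_mx1_neq0 (x : 'cV[R]_n) : col_mx x (1%:M : 'cV[R]_1) != 0.
Proof.
apply/eqP => /matrixP/(_ (rshift n ord0) 0).
by rewrite col_mxEd !mxE => /eqP; rewrite oner_eq0.
Qed.

Lemma proj_h_continuous : continuous (@proj_h R n).
Proof.
apply: proj_class_continuous => [x|x]; last exact: col_mx1_neq0.
apply: (cvg_mx (nbhs x)) => i j; case: (split_ordP i) => k ->.
  rewrite (ord1 j) col_mxEu; under eq_cvg do rewrite col_mxEu.
  exact: coord_continuous.
by rewrite col_mxEd; under eq_cvg do rewrite col_mxEd; exact: cvg_cst.
Qed.

Definition affine_coord (y : 'cV[R]_(n + 1)) : 'cV[R]_n :=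
  (dsubmx y 0 0)^-1 *: usubmx y.

(** Degree-0 homogeneity makes [affine_coord] a function of the projective point; with [0^-1 = 0] it
    holds at infinity too. *)
Lemma affine_coord_scale c y : c != 0 -> affine_coord (c *: y) = affine_coord y.
Proof.
move=> c0; have dE : dsubmx (c *: y) 0 0 = c * dsubmx y 0 0 by rewrite !mxE.
by rewrite /affine_coord dE linearZ/= scalerA invfM mulrAC mulVf// mul1r.
Qed.

Lemma affine_coord_col_mx x : affine_coord (col_mx x 1%:M) = x.
Proof. by rewrite /affine_coord col_mxKu col_mxKd mxE eqxx invr1 scale1r. Qed.

Lemma affine_coord_continuous y : dsubmx y 0 0 != 0 ->
  {for y, continuous affine_coord}.
Proof.
move=> y0; apply: (cvg_mx (nbhs y)) => i j.
rewrite (ord1 j); under eq_cvg do rewrite /affine_coord 3!mxE.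
rewrite /affine_coord 3!mxE; apply: cvgM.
  apply: cvgV; last exact: coord_continuous.
  by move: y0; rewrite mxE.
exact: coord_continuous.
Qed.

Definition proj_h_inv (p : proj_space R n) : 'cV[R]_n :=
  affine_coord (proj_repr p).

Lemma proj_hK : cancel (@proj_h R n) proj_h_inv.
Proof.
move=> x; rewrite /proj_h_inv /proj_h.
have [c c0 ->] := proj_repr_class (col_mx x 1%:M) (col_mx1_neq0 x).
by rewrite affine_coord_scale// affine_coord_col_mx.
Qed.

Lemma proj_h_inv_class y : y != 0 -> proj_h_inv (proj_class y) = affine_coord y.
Proof.
by move=> /proj_repr_class[c c0]; rewrite /proj_h_inv => ->; rewrite affine_coord_scale.
Qed.

Lemma dsubmx_proj_repr_affine p : proj_affine R n p -> dsubmx (proj_repr p) 0 0 != 0.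
Proof.
move=> [x _ <-]; have [c c0 ->] := proj_repr_class (col_mx x 1%:M) (col_mx1_neq0 x).
by rewrite linearZ/= col_mxKd !mxE eqxx mulr1.
Qed.

(** [proj_repr] is an arbitrary choice of representative, so continuity is not obtained by
    composition. Instead an open set of points is exhibited through its preimage among nonzero
    vectors, where [affine_coord] is continuous. *)
Lemma proj_h_inv_continuous p : proj_affine R n p ->
  {for p, continuous proj_h_inv}.
Proof.
move=> Pp V; rewrite nbhsE/= => -[W [oW Wp] WV].
have p0 := dsubmx_proj_repr_affine _ Pp.
pose O : set (proj_space R n) :=
  [set q | dsubmx (proj_repr q) 0 0 != 0 /\ W (proj_h_inv q)].
apply: (@filterS _ _ _ O); first by move=> q [_ Wq]; exact: WV.
apply: open_nbhs_nbhs; split; last by split.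
pose Q : set 'cV[R]_(n + 1) := [set y | dsubmx y 0 0 != 0 /\ W (affine_coord y)].
have oQ : open Q.
  rewrite openE => y [y0 Wy]; rewrite /interior.
  have near_d : \forall z \near y, dsubmx z 0 0 != 0.
    have dC : (fun z : 'cV[R]_(n + 1) => dsubmx z 0 0) z @[z --> y] --> dsubmx y 0 0.
      by rewrite mxE; under eq_cvg do rewrite mxE; exact: coord_continuous.
    apply: (dC [set r : R | r != 0]).
    by apply: open_nbhs_nbhs; split => //; exact: open_neq.
  have near_W : \forall z \near y, W (affine_coord z).
    by apply: affine_coord_continuous => //; exact: open_nbhs_nbhs.
  by apply: filterS2 near_d near_W => z.
(* Both conditions are invariant under rescaling, so any representative may be tested. *)
have OQ y : y != 0 -> O (proj_class y) <-> Q y.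
  move=> y0; rewrite /O /Q /= proj_h_inv_class//.
  have [c c0 ->] := proj_repr_class _ y0.
  have -> : dsubmx (c *: y) 0 0 = c * dsubmx y 0 0 by rewrite !mxE.
  by rewrite mulf_eq0 (negbTE c0).
(* Openness in the quotient: the preimage of [O] among nonzero vectors is the trace of the open set
   [Q]. *)
exists Q => //; apply/seteqP; split => z; have z0 : set_val z != 0.
- by have := valP z; rewrite inE.
- by rewrite /preimage/= pi_nonzero_class => /(OQ _ z0).
- by have := valP z; rewrite inE.
- move=> Oz; apply/(OQ _ z0); rewrite -[proj_class _]pi_nonzero_class.
  exact: Oz.
Qed.

End projective_chart.

Lemma homeomorphism_on_proj_h {R : realType} (n : nat) :
  homeomorphism_on [set: 'cV[R]_n] (proj_affine R n) (@proj_h R n).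
Proof.
split.
- split => //; first by move=> x _; exists x.
  by move=> x y _ _; exact: (can_inj proj_hK).
- exact: continuous_subspaceT (@proj_h_continuous R n).
exists (@proj_h_inv R n); last by move=> x _; exact: proj_hK.
apply/subspace_continuousP => p Pp.
exact: cvg_within_filter (proj_h_inv_continuous _ Pp).
Qed.

Lemma homeomorphism_on_id_prod {C S T : topologicalType} (U : set C)
    (X : set S) (Y : set T) (f : S -> T) :
  homeomorphism_on X Y f ->
  homeomorphism_on (U `*` X) (U `*` Y) (fun p => (p.1, f p.2)).
Proof.
have prodC (S' T' : topologicalType) (X' : set S') (g : S' -> T') :
    {within X', continuous g} ->
    {within U `*` X', continuous (fun p : C * S' => (p.1, g p.2))}.
  move=> /subspace_continuousP gC; apply/subspace_continuousP.
  move=> [u x] [/= Uu Xx] V [[A B] /= [uA gB]] ABV.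
  exists (A, [set y | X' y -> B (g y)]) => /=; first by split => //; exact: gC gB.
  by move=> [v y] [/= Av By] [_ Xy]; apply: ABV; split => //=; exact: By.
move=> [[fXY finj fsurj] fC [g gC fK]]; split.
- split.
  + by move=> [u x] [/= Uu Xx]; split => //=; exact: fXY.
  + move=> [u x] [v y]; rewrite !inE => -[/= _ Xx] [/= _ Xy] [-> fxy].
    by congr pair; apply: finj => //; rewrite inE.
  + by move=> [u y] [/= Uu /fsurj[x Xx <-]]; exists (u, x).
- exact: prodC.
exists (fun p => (p.1, g p.2)); first exact: prodC.
by move=> [u x] [/= Uu Xx]; rewrite fK.
Qed.

(** * Uniqueness for linear control systems *)

Section bounds.
Context {R : realType}.
Local Notation leb := (@lebesgue_measure R).

Lemma compact_entries_bounded (N : nat) (K : set 'cV[R]_N) : compact K ->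
  exists2 M, 0 <= M & forall x, K x -> forall i, `|x i 0| <= M.
Proof.
move=> Kc.
have bi i : exists M, 0 <= M /\ forall x, K x -> `|x i 0| <= M.
  have : compact ((fun x : 'cV[R]_N => x i 0) @` K).
    apply: continuous_compact => //; apply: continuous_subspaceT.
    exact: coord_continuous.
  move=> /(@compact_bounded R R^o)[M [_ MP]].
  exists (`|M| + 1); split; first by rewrite addr_ge0.
  move=> x Kx; apply: (MP (`|M| + 1)); last by exists x.
  by rewrite (le_lt_trans (ler_norm _))// ltrDl.
have [M MP] := choice bi.
exists (\sum_i M i); first by apply: sumr_ge0 => i _; exact: (MP i).1.
move=> x Kx i; apply: le_trans ((MP i).2 x Kx) _.
by rewrite (bigD1 i)//= lerDl; apply: sumr_ge0 => j _; exact: (MP j).1.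
Qed.

Lemma ae_lebesgueS (P Q : R -> Prop) : (forall s, P s -> Q s) ->
  (\forall s \ae leb, P s) -> (\forall s \ae leb, Q s).
Proof.
exact: (@filterS _ _ (@ae_filter_ringOfSetsType _ (measurableTypeR R) R leb)).
Qed.

(** Both conclusions come from one bound on the integral of the absolute value of [f]. *)
Lemma ae_bounded_integrable (D : set (measurableTypeR R)) (f : R -> R) (M : R) :
  measurable D -> (leb D < +oo)%E -> measurable_fun D f -> 0 <= M ->
  (\forall s \ae leb, D s -> `|f s| <= M) -> leb.-integrable D (EFin \o f) /\
  `|\int[leb]_(s in D) f s| <= M * fine (leb D).
Proof.
move=> mD Dfin mf M0 fM.
have le : (\int[leb]_(s in D) `|(EFin \o f) s| <= M%:E * leb D)%E.
  apply: integral_le_bound => //; first exact/measurable_EFinP.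
have intf : leb.-integrable D (EFin \o f).
  apply/integrableP; split; first exact/measurable_EFinP.
  by apply: le_lt_trans le _; rewrite lte_mul_pinfty.
split => //; rewrite -lee_fin EFin_normr_Rintegral//.
rewrite EFinM fineK ?ge0_fin_numE//; apply: le_trans le.
by apply: le_abse_integral => //; exact/measurable_EFinP.
Qed.

End bounds.

(** * Linearity, bounds and measurability of the homogeneous vector field *)

Section linear_system.
Context {R : realType} (N m : nat) (B : 'I_m.+1 -> 'M[R]_N).
Local Notation leb := (@lebesgue_measure R).
Local Notation vf := (vector_field B (fun=> 0)).

Lemma linear_vector_fieldB w x y (c : R) i :
  vf w (x - c *: y) i 0 = vf w x i 0 - c * vf w y i 0.
Proof.
suff -> : vf w (x - c *: y) = vf w x - c *: vf w y by rewrite !mxE.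
rewrite /vector_field !addr0 scalerDr opprD addrACA.
congr (_ + _); first by rewrite mulmxBr scalemxAr.
rewrite scaler_sumr -sumrB; apply: eq_bigr => k _.
by rewrite !addr0 mulmxBr scalerBr -scalemxAr !scalerA mulrC.
Qed.

Lemma linear_vector_field_bounded (K : R) : 0 <= K -> exists2 L, 0 <= L &
  forall (w : 'cV[R]_m) (x : 'cV[R]_N) M, (forall k, `|w k 0| <= K) -> (forall j, `|x j 0| <= M) ->
  forall i, `|vf w x i 0| <= L * M.
Proof.
move=> K0; pose c k := \sum_i \sum_j `|B k i j|.
have c0 k : 0 <= c k by apply: sumr_ge0 => i _; apply: sumr_ge0.
have Bx k (x : 'cV[R]_N) M i : (forall j, `|x j 0| <= M) -> `|(B k *m x) i 0| <= c k * M.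
  move=> xM; rewrite mxE; apply: le_trans (ler_norm_sum _ _ _) _.
  apply: (@le_trans _ _ (\sum_j `|B k i j| * M)).
    by apply: ler_sum => j _; rewrite normrM ler_wpM2l.
  rewrite -mulr_suml ler_wpM2r//.
    (* The sign of [M] comes from the entry with index 0, which exists because [i] rules out
       [N = 0]. *)
    by case: N x i xM => [x []//|p x i xM]; apply: le_trans (xM 0).
  by rewrite /c [leRHS](bigD1 i)//= lerDl; apply: sumr_ge0 => ? _; apply: sumr_ge0.
exists (c ord0 + \sum_(k < m) K * c (lift ord0 k)).
  by rewrite addr_ge0// sumr_ge0// => k _; rewrite mulr_ge0.
move=> w x M wK xM i; rewrite /vector_field addr0 mxE mulrDl.
apply: le_trans (ler_normD _ _) _; rewrite lerD//; first exact: Bx.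
rewrite summxE mulr_suml; apply: le_trans (ler_norm_sum _ _ _) _.
apply: ler_sum => k _; rewrite addr0 mxE normrM -mulrA.
by rewrite ler_pM//; exact: Bx.
Qed.

Lemma linear_vector_field_measurable (u : control R m) (phi : R -> 'cV[R]_N) i
    (D : set (measurableTypeR R)) : continuous phi ->
  measurable_fun D (fun s => vf (control_at u s) (phi s) i 0 : R).
Proof.
move=> phiC; apply: measurable_funTS.
have mB k : measurable_fun [set: measurableTypeR R] (fun s => (B k *m phi s) i 0 : R).
  rewrite (_ : (fun s => _) = (fun s => \sum_j B k i j * phi s j 0)); last first.
    by apply/funext => s; rewrite mxE.
  apply: measurable_sum => j; apply: measurable_funM => //.
  apply: continuous_measurable_fun => s.
  exact: (continuous_comp (phiC s) (@coord_continuous _ _ _ j 0 (phi s))).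
rewrite (_ : (fun s => _) = (fun s => (B ord0 *m phi s) i 0 +
    \sum_(k < m) (u : 'cV[Linf R]_m) k 0 s * (B (lift ord0 k) *m phi s) i 0)); last first.
  apply/funext => s; rewrite /vector_field addr0 mxE summxE; congr (_ + _).
  by apply: eq_bigr => k _; rewrite addr0 !mxE.
apply: measurable_funD => //; apply: measurable_sum => k.
apply: measurable_funM => //. exact: (@measurable_funPT _ _ _ _ (repr (LebesgueSpace.sort ((u : 'cV[Linf R]_m) k 0)))).
Qed.

End linear_system.

Lemma linear_vector_field0 {R : realType} (N m : nat) (B : 'I_m.+1 -> 'M[R]_N) w :
  vector_field B (fun=> 0) w 0 = 0.
Proof.
by rewrite /vector_field mulmx0 !addr0 add0r big1// => k _; rewrite mulmx0 addr0 scaler0.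
Qed.

Section uniqueness.
Context {R : realType}.
Local Notation leb := (@lebesgue_measure R).

Lemma fine_lebesgue_itv (a b : R) (p q : bool) : a <= b ->
  fine (leb [set` Interval (BSide p a) (BSide q b)]) = b - a.
Proof.
move=> ab; rewrite lebesgue_measure_itv/= lte_fin; case: ltP => // ba.
by rewrite (@le_anti _ _ a b) ?ab// subrr.
Qed.

Lemma lebesgue_itv_fin (a b : R) (p q : bool) :
  (leb [set` Interval (BSide p a) (BSide q b)] < +oo)%E.
Proof. by rewrite lebesgue_measure_itv/=; case: ifP => //; rewrite ltry. Qed.

(* On steps [b - a = h] with [L * h <= 1 / 2], the supremum of the entries of [D]
   over [-b, b] is at most half of itself. *)
Lemma vanish_of_interval_contraction (N : nat) (D : R -> 'cV[R]_N) (L : R) :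
  0 <= L -> continuous D ->
  (forall M a b, 0 <= M -> 0 <= a -> a <= b -> (forall s, `|s| <= a -> D s = 0) ->
     (forall s i, `|s| <= b -> `|D s i 0| <= M) ->
     forall s i, `|s| <= b -> `|D s i 0| <= L * M * (b - a)) ->
  D 0 = 0 -> forall s, D s = 0.
Proof.
move=> L0 DC contr D0.
(* The [+ 1] keeps the step length positive when [L = 0]. *)
pose h := (2 * L + 1)^-1.
have h0 : 0 < h by rewrite invr_gt0; lra.
have Lh : L * h <= 2^-1.
  by rewrite ler_pdivrMr; lra.
suff steps (k : nat) s : `|s| <= k%:R * h -> D s = 0.
  move=> s; pose k := Num.Def.truncn (`|s| / h).
  apply: (steps k.+1); rewrite -ler_pdivrMr// ltW// truncnS_gt//.
elim: k s => [|k IH] s sk.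
  by move: sk; rewrite mul0r normr_le0 => /eqP ->.
pose b := k.+1%:R * h.
have kh0 : 0 <= k%:R * h by rewrite mulr_ge0// ltW.
have bE : b - k%:R * h = h by rewrite /b -natr1; ring.
have Kc : compact (D @` `[- b, b]).
  by apply: continuous_compact; [exact: continuous_subspaceT|exact: segment_compact].
have [M0 M00 DM0] := compact_entries_bounded _ _ Kc.
(* Adjoining 0 keeps the supremum meaningful and nonnegative even when [N = 0]. *)
pose S := [set r | r = 0 \/ exists s' i, `|s'| <= b /\ r = `|D s' i 0|].
have S0 : S !=set0 by exists 0; left.
have SM0 : ubound S M0.
  move=> r [->//|[s' [i [s'b ->]]]]; apply: DM0.
  by exists s' => //=; rewrite in_itv/= -ler_norml.
have supS : has_sup S by split => //; exists M0.
have S_le r : S r -> r <= sup S by move=> Sr; exact: (ub_le_sup supS.2).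
have supS0 : 0 <= sup S by apply: S_le; left.
have half : sup S <= sup S / 2.
  apply: ge_sup => // r [->|[s' [i [s'b ->]]]]; first by rewrite divr_ge0.
  have := contr (sup S) (k%:R * h) b supS0 kh0 _ IH.
  have kb : k%:R * h <= b by lra.
  move=> /(_ kb)/(_ (fun s i sb => S_le _ (or_intror (ex_intro _ s (ex_intro _ i (conj sb erefl)))))).
  by move=> /(_ s' i s'b); rewrite bE; nra.
have sup0 : sup S = 0 by lra.
apply/matrixP => i j; rewrite (ord1 j) mxE; apply/eqP; rewrite -normr_le0 -sup0.
by apply: S_le; right; exists s, i.
Qed.

Variables (N m : nat) (B : 'I_m.+1 -> 'M[R]_N).
Local Notation vf := (vector_field B (fun=> 0)).
Variables (Omega : set 'cV[R]_m) (u : control R m).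
Hypothesis Omega_compact : compact Omega.
Hypothesis Uu : admissible Omega u.

Lemma admissible_bounded : exists2 K, 0 <= K &
  \forall s \ae leb, forall k, `|control_at u s k 0| <= K.
Proof.
have [K K0 OK] := compact_entries_bounded _ _ Omega_compact.
exists K => //; apply: ae_lebesgueS Uu => s Os k; exact: OK.
Qed.

(** Compactness of [Omega] bounds the control essentially, with [L] independent of the curve and the
    interval. The brackets are free because splitting integrals produces closed and half-open
    intervals. *)
Lemma linear_vector_field_integral : exists2 L, 0 <= L &
  forall (phi : R -> 'cV[R]_N) M a b (p q : bool), continuous phi -> 0 <= M ->
  a <= b ->
  (forall s j, a <= s <= b -> `|phi s j 0| <= M) -> forall i,
  let I := [set` Interval (BSide p a) (BSide q b)] in
  leb.-integrable I (fun s => (vf (control_at u s) (phi s) i 0)%:E) /\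
  `|\int[leb]_(s in I) vf (control_at u s) (phi s) i 0| <= L * M * (b - a).
Proof.
have [K K0 uK] := admissible_bounded.
have [L L0 LP] := linear_vector_field_bounded _ _ B K K0.
exists L => // phi M a b p q phiC M0 ab phiM i I.
rewrite -(fine_lebesgue_itv a b p q ab).
rewrite {}/I; apply: ae_bounded_integrable => //.
- exact: lebesgue_itv_fin.
- exact: linear_vector_field_measurable.
- exact: mulr_ge0.
apply: ae_lebesgueS uK => s us Is; apply: LP => // j; apply: phiM.
move: Is; rewrite /= in_itv/= => /andP[].
by move=> /lteifW -> /lteifW ->.
Qed.

(** By linearity [phi1 - c *: phi2] satisfies the integral equation with initial value 0, and the
    contraction argument makes it vanish. The factor [c] gives uniqueness and homogeneity at
    once. *)
Lemma linear_solution_unique (x1 x2 : 'cV[R]_N) (phi1 phi2 : R -> 'cV[R]_N) c :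
  is_solution B (fun=> 0) u x1 phi1 -> is_solution B (fun=> 0) u x2 phi2 ->
  x1 = c *: x2 -> forall t, phi1 t = c *: phi2 t.
Proof.
move=> [phi1C sol1] [phi2C sol2] x12 t; apply/eqP; rewrite -subr_eq0; apply/eqP.
have [L L0 LP] := linear_vector_field_integral.
have bounded (phi : R -> 'cV[R]_N) : continuous phi -> forall a b, exists2 M, 0 <= M &
    forall s j, a <= s <= b -> `|phi s j 0| <= M.
  move=> phiC a b.
  have [|M M0 MP] := compact_entries_bounded N (phi @` `[a, b]).
    by apply: continuous_compact; [exact: continuous_subspaceT|exact: segment_compact].
  by exists M => // s j sab; apply: MP; exists s => //=; rewrite in_itv.
have intv (phi : R -> 'cV[R]_N) (a b : R) i : continuous phi ->
    leb.-integrable `[a, b] (fun s => (vf (control_at u s) (phi s) i 0)%:E).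
  move=> phiC; have [ab|ba] := leP a b; last first.
    by rewrite set_itv_ge -?leNgt ?bnd_simp -?ltNge//; exact: integrable_set0.
  have [M M0 MP] := bounded phi phiC a b.
  by have [] := LP phi M a b true false phiC M0 ab MP i.
pose D s := phi1 s - c *: phi2 s.
have DC : continuous D.
  by move=> s; apply: cvgB; [exact: phi1C|apply: cvgZl_tmp; exact: phi2C].
pose f i s := vf (control_at u s) (D s) i 0.
have DE s i : D s i 0 = integral_from0 (f i) s.
  rewrite !mxE sol1 sol2 x12 !mxE /integral_from0.
  have E a b : \int[leb]_(r in `[a, b]) f i r =
      \int[leb]_(r in `[a, b]) vf (control_at u r) (phi1 r) i 0 -
      c * \int[leb]_(r in `[a, b]) vf (control_at u r) (phi2 r) i 0.
    have int1 := intv phi1 a b i phi1C; have int2 := intv phi2 a b i phi2C.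
    rewrite -RintegralZl// -RintegralB//; last first.
      rewrite (_ : _ \o _ = fun r => (c%:E * (vf (control_at u r) (phi2 r) i 0)%:E)%E)//.
      exact: integrableZl.
    by apply: eq_Rintegral => r _; rewrite /f linear_vector_fieldB.
  by case: ifP => _; rewrite E; ring.
apply: (vanish_of_interval_contraction N D L) => //; last first.
  apply/matrixP => i j; rewrite (ord1 j) DE /integral_from0 lexx set_itv1.
  by rewrite Rintegral_set1 mxE.
move=> M a b M0 a0 ab Da DM s i sb.
have [sa|as_] := leP `|s| a.
  by rewrite Da// mxE normr0 mulr_ge0 ?mulr_ge0// subr_ge0.
have f0 r j : `|r| <= a -> f j r = 0.
  by move=> ra; rewrite /f Da// linear_vector_field0 mxE.
rewrite DE /integral_from0; case: ifPn => [s0|].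
  rewrite ger0_norm// in as_ sb.
  (* The integrand vanishes on [[0, a]], so only []a, s]] contributes, of length at most [b - a]. *)
  have := @Rintegral_itvB R (f i) (BLeft 0) (BRight s) a (intv _ _ _ _ DC).
  rewrite !bnd_simp => /(_ a0 (ltW as_)).
  rewrite [X in _ - X](_ : _ = 0) ?subr0; last first.
    rewrite (@eq_Rintegral _ _ _ leb _ (cst 0)) ?Rintegral_cst ?mul0r//.
    by move=> r; rewrite inE/= in_itv/= => /andP[r0 ra]; rewrite f0// ger0_norm.
  move=> ->.
  have [|_] := LP D M a s false false DC M0 (ltW as_) _ i.
    move=> r j /andP[ar rs]; apply: DM; rewrite ger0_norm ?(le_trans rs)//.
    exact: le_trans a0 ar.
  move=> /le_trans; apply; rewrite ler_wpM2l ?mulr_ge0//; lra.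
rewrite -ltNge => s0; rewrite ltr0_norm// in as_ sb; rewrite normrN.
(* Backward in time the part over []-a, 0]] vanishes and [[s, -a]] remains. *)
have := @Rintegral_itvB R (f i) (BLeft s) (BRight 0) (- a) (intv _ _ _ _ DC).
rewrite !bnd_simp => /(_ _ _)/eqP; rewrite subr_eq => /(_ _ _)/eqP ->; [|lra|lra].
rewrite [X in X + _](_ : _ = 0) ?add0r; last first.
  rewrite (@eq_Rintegral _ _ _ leb _ (cst 0)) ?Rintegral_cst ?mul0r//.
  move=> r; rewrite inE/= in_itv/= => /andP[ar r0]; rewrite f0// ler0_norm//; lra.
have [||_] := LP D M s (- a) true false DC M0 _ _ i; first by lra.
  move=> r j /andP[sr ra]; apply: DM; rewrite ler0_norm; lra.
move=> /le_trans; apply; rewrite ler_wpM2l ?mulr_ge0//; lra.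
Qed.

End uniqueness.

(** * The induced system *)

(** Translation preserves null sets, and each entry of the shifted control agrees with the translate
    off a null set; there are finitely many entries. *)
Lemma admissible_shift {R : realType} (m : nat) (Omega : set 'cV[R]_m) t u :
  admissible Omega u -> admissible Omega (control_shift t u).
Proof.
move=> /(ae_translation t) Uu; rewrite /admissible/=.
have FF := @ae_filter_ringOfSetsType _ (measurableTypeR R) R (@lebesgue_measure R).
have shiftE : \forall s \ae (@lebesgue_measure R), forall k : 'I_m,
    control_at (control_shift t u) s k 0 = control_at u (t + s) k 0.
  apply: (@filter_forall _ _ _ _ FF) => k.
  apply: ae_lebesgueS (Linf_shift_ae t ((u : 'cV[Linf R]_m) k 0)) => s us.
  by rewrite !mxE us.
apply: (@filterS2 _ _ FF _ _ _ _ shiftE Uu) => s us Os.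
suff -> : control_at (control_shift t u) s = control_at u (t + s) by [].
by apply/matrixP => i j; rewrite (ord1 j) us.
Qed.

(** The last coordinate 1 multiplies the column [a k], and the zero bottom row freezes that
    coordinate. *)
Lemma vector_field_bilinear {R : realType} (n m : nat)
    (A : 'I_m.+1 -> 'M[R]_n) (a : 'I_m.+1 -> 'cV[R]_n) w x :
  vector_field (bilinear_part A a) (fun=> 0) w (col_mx x 1%:M) =
  col_mx (vector_field A a w x) 0.
Proof.
have BE k : bilinear_part A a k *m col_mx x 1%:M + 0 = col_mx (A k *m x + a k) 0.
  by rewrite mul_block_col !mul0mx mulmx1 !addr0.
rewrite /vector_field BE; under eq_bigr do rewrite BE scale_col_mx scaler0.
have -> (F : 'I_m -> 'cV[R]_n) :
    \sum_k col_mx (F k) (0 : 'cV[R]_1) = col_mx (\sum_k F k) 0.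
  apply/matrixP => i j; rewrite summxE; case: (split_ordP i) => k ->.
    by rewrite col_mxEu summxE; apply: eq_bigr => l _; rewrite col_mxEu.
  by rewrite col_mxEd big1 ?mxE// => l _; rewrite col_mxEd mxE.
by rewrite add_col_mx addr0.
Qed.

Lemma is_solution_bilinear {R : realType} (n m : nat)
    (A : 'I_m.+1 -> 'M[R]_n) (a : 'I_m.+1 -> 'cV[R]_n) u x phi :
  is_solution A a u x phi ->
  is_solution (bilinear_part A a) (fun=> 0) u (col_mx x 1%:M)
    (fun t => col_mx (phi t) 1%:M).
Proof.
move=> [phiC sol]; split.
  move=> t; apply: (cvg_mx (nbhs t)) => i j; case: (split_ordP i) => k ->.
    rewrite (ord1 j) col_mxEu; under eq_cvg do rewrite col_mxEu.
    exact: (continuous_comp (phiC t) (@coord_continuous _ _ _ k 0 (phi t))).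
  by rewrite col_mxEd; under eq_cvg do rewrite col_mxEd; exact: cvg_cst.
move=> t i; case: (split_ordP i) => k ->.
  rewrite !col_mxEu sol; congr (_ + integral_from0 _ t).
  by apply/funext => s; rewrite vector_field_bilinear col_mxEu.
rewrite !col_mxEd; under eq_fun do rewrite vector_field_bilinear col_mxEd mxE.
rewrite /integral_from0 -[LHS]addr0; congr (_ + _).
by case: ifP => _; rewrite -/(cst 0) Rintegral_cst// mul0r ?oppr0.
Qed.

Section conjugacy.
Context {R : realType} {n m : nat}.
Variables (A : 'I_m.+1 -> 'M[R]_n) (a : 'I_m.+1 -> 'cV[R]_n).
Variable Omega : set 'cV[R]_m.
Hypothesis Omega_compact : compact Omega.
Variable psi : R -> 'cV[R]_n -> control R m -> 'cV[R]_n.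
Hypothesis psi_sol : solution_map A a (admissible Omega) psi.
Variable psi1 : R -> 'cV[R]_(n + 1) -> control R m -> 'cV[R]_(n + 1).
Hypothesis psi1_sol :
  solution_map (bilinear_part A a) (fun=> 0) (admissible Omega) psi1.

(** The chosen representative of [proj_h n x] is [(x, 1)] only up to an unknown factor [c]; the
    solution from it is [c] times [(psi, 1)], which has the same class. *)
Lemma proj_trajectory_proj_h t x u : admissible Omega u ->
  proj_trajectory psi1 t (proj_h n x) u = proj_h n (psi t x u).
Proof.
move=> Uu; rewrite /proj_trajectory /proj_h.
have [c c0 ->] := proj_repr_class _ (col_mx1_neq0 x).
have lin := linear_solution_unique _ _ _ _ _ Omega_compact Uu _ _ _ _ c
  (psi1_sol u (c *: col_mx x 1%:M) Uu)
  (is_solution_bilinear _ _ _ _ _ _ _ (psi_sol u x Uu)) erefl t.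
rewrite /= in lin; rewrite lin.
by rewrite proj_class_scale// col_mx1_neq0.
Qed.

End conjugacy.

Theorem theorem7 (R : realType) (n m : nat)
    (A : 'I_m.+1 -> 'M[R]_n) (a : 'I_m.+1 -> 'cV[R]_n)
    (Omega : set 'cV[R]_m)
    (Omega_convex : convex_set Omega) (Omega_compact : compact Omega)
    (Omega_nbhs : nbhs (0 : 'cV[R]_m) Omega)
    (dU : control R m -> control R m -> R)
    (dU_metric : metric_on (admissible Omega) dU)
    (dP : proj_space R n -> proj_space R n -> R)
    (dP_metric : metric_on [set: proj_space R n] dP)
    (psi : R -> 'cV[R]_n -> control R m -> 'cV[R]_n)
    (psi_sol : solution_map A a (admissible Omega) psi)
    (psi1 : R -> 'cV[R]_(n + 1) -> control R m -> 'cV[R]_(n + 1))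
    (psi1_sol : solution_map (bilinear_part A a) (fun=> 0)
                  (admissible Omega) psi1) :
  let U := admissible Omega in
  let Psi := control_flow psi in
  let PPsi1 := control_flow (proj_trajectory psi1) in
  let URn := U `*` [set: 'cV[R]_n] in
  let UPn1 := U `*` proj_affine R n in
  [/\ homeomorphism_on URn UPn1 (id_proj_h n m) /\
      (forall t u x, U u ->
         id_proj_h n m (Psi t (u, x)) = PPsi1 t (u, proj_h n x)),
      [set id_proj_h n m @` Y | Y in
         max_inv_strongly_chain_transitive URn
           (max_dist dU (euclidean_dist n)) Psi] =
      max_inv_strongly_chain_transitive UPn1 (max_dist dU dP) PPsi1 &
      [set proj_h n @` E | E in
         strong_chain_control_sets [set: 'cV[R]_n]
           (euclidean_dist n) U psi] =
      strong_chain_control_sets (proj_affine R n) dP U (proj_trajectory psi1)].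
Proof.
move=> U Psi PPsi1 URn UPn1.
have homeo := homeomorphism_on_proj_h n (R := R).
have homeoU : homeomorphism_on URn UPn1 (id_proj_h n m).
  exact: homeomorphism_on_id_prod homeo.
have psiE := proj_trajectory_proj_h A a Omega Omega_compact psi psi_sol psi1 psi1_sol.
have conj t u x : U u -> id_proj_h n m (Psi t (u, x)) = PPsi1 t (u, proj_h n x).
  by move=> Uu; rewrite /id_proj_h /PPsi1 /control_flow /= psiE.
have mPn1 : metric_on (proj_affine R n) dP by exact: metric_on_subset dP_metric.
split => //.
- apply: image_max_inv_strongly_chain_transitive => //.
  + by apply: metric_on_prod => //; exact: metric_on_euclidean.
  + exact: metric_on_prod.
  (* The flow stays over admissible controls because they are closed under time shifts. *)
  + by move=> t [u x] [/= Uu _]; split => //=; exact: admissible_shift.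
  + by move=> t [u x] [/= Uu _]; exact: conj.
apply: image_strong_chain_control_sets => //; first exact: metric_on_euclidean.
by move=> t x u _ Uu; rewrite psiE.
Qed.
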